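(* Let $G$ be a connected graph with at least two vertices and girth at least $7$ (trees included). Then $\dim_{n\ell}(G)\le \beta'(G)-1$. Moreover, if $G$ is a tree, then $\dim_{n\ell}(G)=\beta'(G)-1$ if and only if $G$ is obtained from a star $K_{1,m}$ ($m\ge 1$) by keeping one of its edges unchanged and subdividing each of the remaining edges at most once (i.e., replacing each remaining edge either by itself or by a path of length $2$).
   Context: Graphs are finite, simple and connected; $d_G(u,v)$ is the shortest-path distance. The girth is the length of a shortest cycle (infinite for acyclic graphs). The edge cover number $\beta'(G)$ is the minimum number of edges such that every vertex is incident with at least one of them. A set $X\subseteq V(G)$ resolves two vertices $u,v$ if some $x\in X$ satisfies $d_G(u,x)\neq d_G(v,x)$. $X$ is a nonlocal resolving set if it resolves every pair of distinct non-adjacent vertices; the nonlocal metric dimension $\dim_{n\ell}(G)$ is the minimum size of a nonlocal resolving set (so $\dim_{n\ell}(K_n)=0$). *)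

(* Defs.v *)
(* A simple graph is a symmetric irreflexive relation
   e : rel T on a finite type T. *)
From mathcomp Require Import all_boot all_order.
Set Implicit Arguments. Unset Strict Implicit. Unset Printing Implicit Defensive.

Section Graphs.
Variables (T : finType) (e : rel T).

Definition connectedG : Prop := forall x y : T, connect e x y.

Definition walkb (k : nat) (x y : T) : bool :=
  [exists p : k.-tuple T, path e x p && (last x p == y)].

(* shortest-path distance: least k with a walk of length k from x to y
   (for a connected graph this is < #|T|) *)
Definition dist (x y : T) : nat := find (fun k => walkb k x y) (iota 0 #|T|).

Definition is_cycle (p : seq T) : bool := [&& uniq p, cycle e p & 3 <= size p].

(* girth(G) >= g  (vacuous for acyclic graphs: girth = infinity) *)
Definition girth_ge (g : nat) : Prop :=
  forall p : seq T, is_cycle p -> g <= size p.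

Definition acyclic : Prop := forall p : seq T, ~~ is_cycle p.

Definition is_tree : Prop := connectedG /\ acyclic.

Definition edge_set : {set {set T}} :=
  [set [set p.1; p.2] | p in [set p : T * T | e p.1 p.2]].

Definition edge_coverb (F : {set {set T}}) : bool :=
  (F \subset edge_set) && [forall v : T, [exists A in F, v \in A]].

(* edge cover number beta'(G): minimum size of an edge cover
   (the default #|T| is never attained below the true minimum when an
    edge cover exists, i.e. when G has no isolated vertex) *)
Definition edge_cover_number : nat :=
  \big[minn/#|T|]_(F : {set {set T}} | edge_coverb F) #|F|.

Definition resolves (X : {set T}) (u v : T) : bool :=
  [exists x in X, dist u x != dist v x].

Definition nonlocal_resolvingb (X : {set T}) : bool :=
  [forall u : T, forall v : T, ((u != v) && ~~ e u v) ==> resolves X u v].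

(* nonlocal metric dimension (setT is always nonlocal resolving, so the
   default #|T| is harmless) *)
Definition nl_dim : nat :=
  \big[minn/#|T|]_(X : {set T} | nonlocal_resolvingb X) #|X|.

End Graphs.

(* The spider obtained from the star K_{1,m} (legs indexed by 'I_m) by
   subdividing exactly the edges indexed by S once.
   Vertices: None = centre, Some (i,false) = neighbour of the centre on leg i,
   Some (i,true) = second vertex on leg i (present iff i \in S). *)
Definition spider_valid (m : nat) (S : {set 'I_m}) (x : option ('I_m * bool)) : bool :=
  match x with
  | None => true
  | Some (i, false) => true
  | Some (i, true) => i \in S
  end.

Definition spider_vertex (m : nat) (S : {set 'I_m}) :=
  {x : option ('I_m * bool) | spider_valid S x}.

Definition spider_adj_raw (m : nat) (x y : option ('I_m * bool)) : bool :=
  match x, y with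
  | None, Some (_, false) => true
  | Some (_, false), None => true
  | Some (i, false), Some (j, true) => i == j
  | Some (i, true), Some (j, false) => i == j
  | _, _ => false
  end.

Definition spider_adj (m : nat) (S : {set 'I_m}) : rel (spider_vertex S) :=
  fun x y => spider_adj_raw (val x) (val y).

Definition star_subdivision (T : finType) (e : rel T) : Prop :=
  exists (m : nat) (S : {set 'I_m.+1}),
    ord0 \notin S /\
    exists f : T -> spider_vertex S,
      bijective f /\ forall x y : T, e x y = spider_adj (f x) (f y).

(* Main.v *)
(** Taking from each star of a minimum edge cover its leaves gives a resolving set with
    one vertex per edge: two unresolved centres would lie on a 4-cycle.  One more vertex
    can be saved.  If some star has two leaves [x1], [x2], drop [x1]: a vertex not
    resolved from [x1] would close a cycle of length at most 6.  Otherwise the cover is a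
    perfect matching; drop one edge and keep, from each other edge, an endpoint not
    adjacent to the dropped edge.

    In a tree with at least 3 vertices, a nonempty set meeting all but at most one branch
    at every vertex is resolving, so all leaves but one form a resolving set, while the
    edge cover number is at least the number of leaves.  In the equality case the pendant
    edges form a cover, so every inner vertex has a leaf neighbour, and no two leaves can
    be dropped; this forces all inner vertices other than one centre to have degree 2 and
    to be adjacent to the centre.  Conversely, in a subdivided star two neighbours of the
    centre are resolved only by vertices of their own legs, so a resolving set misses at
    most one leg. *)
Require Import Defs.
From mathcomp Require Import all_boot all_order.
From mathcomp Require Import zify.
Set Implicit Arguments. Unset Strict Implicit. Unset Printing Implicit Defensive.

(** * Minima over a finite family, with a default value *)

Section BigMin.
Variables (I : finType) (P : pred I) (F : I -> nat) (n0 : nat).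

Lemma bigminn_le (i : I) : P i -> \big[minn/n0]_(j | P j) F j <= F i.
Proof.
rewrite unlock => Pi; elim: (index_enum I) (mem_index_enum i) => //= j s IHs.
by rewrite inE => /predU1P[<-|/IHs]; [rewrite Pi geq_minl | case: ifP => _ //; lia].
Qed.

Lemma bigminn_ge (m : nat) :
  m <= n0 -> (forall i, P i -> m <= F i) -> m <= \big[minn/n0]_(i | P i) F i.
Proof. by move=> m0 mF; elim/big_rec: _ => // i k /mF; lia. Qed.

Lemma bigminn_eq (i : I) : P i -> F i <= n0 ->
  exists2 j, P j & F j = \big[minn/n0]_(j | P j) F j.
Proof.
move=> Pi Fi; case: (arg_minnP F Pi) => k Pk kmin; exists k => //.
apply/eqP; rewrite eqn_leq bigminn_le // andbT.
by apply: bigminn_ge => //; apply: leq_trans (kmin i Pi) Fi.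
Qed.
End BigMin.

(** * The path metric and minimum edge covers *)

Section Distance.
Variables (T : finType) (e : rel T).
Hypotheses (eS : symmetric e) (eI : irreflexive e) (eC : connectedG e).
Local Notation d := (dist e).

Lemma adj_neq (x y : T) : e x y -> x != y.
Proof. by apply: contraTneq => ->; rewrite eI. Qed.

Lemma dist_path_le (x : T) (p : seq T) : path e x p -> d x (last x p) <= size p.
Proof.
move=> xp; rewrite /dist; set a := fun k => _; set s := iota _ _.
case: (ltnP (size p) #|T|) => [lt_p | le_p]; last first.
  by apply: leq_trans le_p; rewrite -[leqRHS](size_iota 0) find_size.
rewrite leqNgt; apply/negP => /(before_find 0).
rewrite nth_iota // add0n => /existsP[]; exists (in_tuple p).
by rewrite /= xp eqxx.
Qed.

Lemma dist_path (x y : T) :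
  exists p, [/\ path e x p, last x p = y & size p = d x y].
Proof.
have /connectP[q /shortenP[p xp Up _] ->] := eC x y.
pose a k := walkb e k x (last x p); pose s := iota 0 #|T|.
(* A path without repetition has fewer than [#|T|] edges, so the bounded search in [dist]
   succeeds. *)
have lt_p : size p < #|T| by rewrite -[_.+1]/(size (x :: p)) -(card_uniqP Up) max_card.
have : has a s.
  apply/hasP; exists (size p); first by rewrite mem_iota.
  by apply/existsP; exists (in_tuple p); rewrite /= xp eqxx.
move=> has_a; have := nth_find 0 has_a.
have lt_f : find a s < #|T| by rewrite -[ltnRHS](size_iota 0) -has_find.
rewrite nth_iota // add0n => /existsP[t /andP[xt /eqP lt]].
by exists t; rewrite size_tuple.
Qed.

Lemma dist_eq0 (x y : T) : (d x y == 0) = (x == y).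
Proof.
apply/eqP/eqP => [d0 | ->]; last by have := @dist_path_le y [::] isT; case: (d y y).
by have [[|z p] [_ /= py]] := dist_path x y; rewrite d0.
Qed.

Lemma distxx (x : T) : d x x = 0.
Proof. by apply/eqP; rewrite dist_eq0. Qed.

Lemma dist_triangle (x y z : T) : d x z <= d x y + d y z.
Proof.
have [p [xp py <-]] := dist_path x y; have [q [yq qz <-]] := dist_path y z.
rewrite -size_cat -qz -py -last_cat; apply: dist_path_le.
by rewrite cat_path xp py.
Qed.

Lemma dist_sym (x y : T) : d x y = d y x.
Proof.
suff le (u v : T) : d u v <= d v u by apply/eqP; rewrite eqn_leq !le.
have [p [vp pu <-]] := dist_path v u.
rewrite -(size_belast v) -size_rev.
have := @dist_path_le u (rev (belast v p)).
rewrite -{1}pu rev_path (eq_path (e' := e)) => [/(_ vp)|? ?]; last exact: eS.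
by case: p vp pu => [_ /= <- //|a p _ _]; rewrite [belast _ _]/= rev_cons last_rcons.
Qed.

Lemma dist_eq1 (x y : T) : (d x y == 1) = e x y.
Proof.
apply/eqP/idP => [d1 | exy].
  have [p [+ + ]] := dist_path x y; rewrite d1.
  by case: p => [|z []] //=; rewrite andbT => + <-.
have := @dist_path_le x [:: y]; rewrite /= exy => /(_ isT).
by have := dist_eq0 x y; rewrite (negPf (adj_neq exy)); case: (d x y) => [|[]].
Qed.

Lemma adj_dist_le (x y z : T) : e x y -> d x z <= (d y z).+1.
Proof.
by move=> exy; have := dist_triangle x y z; move: exy; rewrite -dist_eq1 => /eqP ->.
Qed.

Lemma dist_step (x y : T) : x != y -> exists2 z, e x z & d x y = (d z y).+1.
Proof.
have [[|z p] [/= + <- dp]] := dist_path x y; first by rewrite eqxx.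
case/andP=> exz zp _; exists z => //; apply/eqP; rewrite eqn_leq adj_dist_le //=.
by rewrite -dp ltnS dist_path_le.
Qed.

Lemma ex_adj (x : T) : 1 < #|T| -> exists y, e x y.
Proof.
move=> /card_gt1P[a [b [_ _ ab]]].
have [y xy] : exists y, x != y.
  by case: (eqVneq x a) => [->|]; [exists b | exists a].
by have [z exz _] := dist_step xy; exists z.
Qed.

Lemma nl_dim_le (X : {set T}) : nonlocal_resolvingb e X -> nl_dim e <= #|X|.
Proof. exact: bigminn_le. Qed.

Lemma nonlocal_resolvingP (X : {set T}) :
  (forall u v, u != v -> ~~ e u v -> (forall x, x \in X -> d u x = d v x) -> False) ->
  nonlocal_resolvingb e X.
Proof.
move=> H; apply/forallP=> u; apply/forallP=> v; apply/implyP=> /andP[uv nuv].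
apply/negbNE/negP=> /existsPn nres; apply: (H u v) => // x xX; apply/eqP.
by have := nres x; rewrite xX negbK.
Qed.

Lemma edge_cover_le (F : {set {set T}}) : edge_coverb e F -> edge_cover_number e <= #|F|.
Proof. exact: bigminn_le. Qed.

Lemma mem_edge_set (x y : T) : e x y -> [set x; y] \in edge_set e.
Proof. by move=> exy; apply/imsetP; exists (x, y); rewrite ?inE. Qed.

Lemma edge_cover_min : 1 < #|T| ->
  exists2 F, edge_coverb e F & #|F| = edge_cover_number e.
Proof.
move=> T2; have /fin_all_exists[n en] := fun x : T => ex_adj x T2.
(* One edge chosen at each vertex gives a cover of at most [#|T|] edges, so the default value cannot
   undercut the true minimum. *)
apply: (@bigminn_eq _ _ _ _ [set [set x; n x] | x in [set: T]]).
  apply/andP; split; first by apply/subsetP=> _ /imsetP[x _ ->]; apply: mem_edge_set.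
  apply/forallP=> v; apply/existsP; exists [set v; n v].
  by rewrite set21 andbT; apply: imset_f.
by rewrite -[leqRHS]cardsT leq_imset_card.
Qed.

(* A minimum edge cover is a spanning forest of stars: [X] collects the leaves of
   the stars (one per edge), and [g] maps a leaf to the centre of its star. *)
Lemma star_forest : 1 < #|T| ->
  exists (X : {set T}) (g : T -> T),
    [/\ #|X| <= edge_cover_number e, forall x, x \in X -> e x (g x),
        forall x, x \in X -> g x \notin X
      & forall v, v \notin X -> exists2 x, x \in X & g x = v].
Proof.
move=> T2; have [F covF cardF] := edge_cover_min T2.
have /card_gt0P[x0 _] : 0 < #|T| by apply: ltnW.
have /andP[/subsetP FE /forallP cF] := covF.
(* Every edge of a minimum cover has an endpoint that no other edge of [F] covers; otherwise the
   edge could be removed. The membership of [A] sits under the existential so that a choice function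
   on all sets can be extracted. *)
have private A : exists xy : T * T, A \in F ->
    [/\ A = [set xy.1; xy.2], e xy.1 xy.2 & forall B, B \in F -> xy.1 \in B -> B = A].
  case AF: (A \in F); last by exists (x0, x0).
  have [x xA xP] : exists2 x, x \in A & forall B, B \in F -> x \in B -> B = A.
    have [/exists_inP[x xA /forall_inP xP] | /exists_inPn nP] :=
        boolP [exists x in A, forall B in F, (x \in B) ==> (B == A)].
      by exists x => // B BF xB; apply/eqP; have /implyP := xP B BF; apply.
    have : edge_coverb e (F :\ A).
      apply/andP; split; first by apply/subsetP=> B /setD1P[_]; apply: FE.
      apply/forallP=> v; have /exists_inP[B BF vB] := cF v.
      case: (eqVneq B A) vB => [-> /nP/forall_inPn[C CF]|BA vB].
        by rewrite negb_imply => /andP[vC CA]; apply/exists_inP; exists C; rewrite ?inE ?CA.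
      by apply/exists_inP; exists B; rewrite ?inE ?BA.
    by move/edge_cover_le; rewrite -cardF (cardsD1 A F) AF add1n ltnn.
  have /imsetP[[a b] ] := FE A AF; rewrite inE /= => eab defA.
  move: xA; rewrite defA => /set2P[] xE; rewrite xE in xP.
    by exists (a, b) => _; split=> //= B; rewrite -defA; apply: xP.
  exists (b, a) => _; split=> /=; rewrite 1?[in RHS]setUC 1?eS //.
  by move=> B; rewrite -defA; apply: xP.
have /fin_all_exists[xy xyP] := private.
pose X := [set (xy A).1 | A in F].
(* A private endpoint lies on a single edge of [F], so [pick] can only return the other end of that
   edge. *)
pose g x := odflt x [pick y | (x != y) && ([set x; y] \in F)].
have gE A : A \in F -> g (xy A).1 = (xy A).2.
  move=> AF; have [AE exy P] := xyP A AF; rewrite /g; case: pickP => [y | /(_ (xy A).2)].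
    case/andP=> xny /P; rewrite set21 => /(_ isT) BA; apply/eqP.
    have : y \in [set (xy A).1; (xy A).2] by rewrite -AE -BA set22.
    by case/set2P=> [yE|->] //=; rewrite -yE eqxx in xny.
  by rewrite -AE AF adj_neq.
exists X, g; split=> [|_ /imsetP[A AF ->]|_ /imsetP[A AF ->]|v vX].
- by rewrite -cardF leq_imset_card.
- by rewrite gE //; case: (xyP A AF).
- rewrite gE //; apply/imsetP=> -[B BF yB].
  have [AE exy _] := xyP A AF; have [_ _ P] := xyP B BF.
  have AB : A = B by apply: P; rewrite // -yB; have := set22 (xy A).1 (xy A).2; rewrite -AE.
  by move: exy; rewrite yB AB eI.
- have /exists_inP[A AF vA] := cF v; have [AE _ _] := xyP A AF.
  have xX : (xy A).1 \in X by apply: imset_f.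
  exists (xy A).1; rewrite ?gE //; have : v \in [set (xy A).1; (xy A).2] by rewrite -AE.
  case/set2P=> [vE|-> //].
  by rewrite vE xX in vX.
Qed.
End Distance.

(** * The upper bound for girth at least 7 *)

Section Girth.
Variables (T : finType) (e : rel T).
Hypotheses (eS : symmetric e) (eI : irreflexive e) (eC : connectedG e).
Hypothesis (eG : girth_ge e 7).
Local Notation d := (dist e).

Let adjneq := adj_neq eI.

Lemma no_short_cycle (p : seq T) : 2 < size p < 7 -> uniq p -> cycle e p -> False.
Proof.
case/andP=> p3 p7 Up Cp; have := @eG p; rewrite /is_cycle Up Cp p3 => /(_ isT).
by rewrite leqNgt p7.
Qed.

Lemma no_triangle (a b c : T) : e a b -> e b c -> e c a -> False.
Proof.
move=> ab bc ca; apply: (@no_short_cycle [:: a; b; c]) => //=; last by rewrite ab bc ca.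
by rewrite !inE !negb_or adjneq // (eq_sym a) !adjneq.
Qed.

Lemma no_C4 (a b c f : T) :
  e a b -> e b c -> e c f -> e f a -> a != c -> b != f -> False.
Proof.
move=> ab bc cf fa ac bf; apply: (@no_short_cycle [:: a; b; c; f]) => //=.
  by rewrite !inE !negb_or ac bf (eq_sym a f) !adjneq.
by rewrite ab bc cf fa.
Qed.

(** Distinctness comes for free: if two vertices two steps apart coincided, the remaining three
    steps would form a triangle. *)
Lemma no_C5 (a b c f g : T) :
  e a b -> e b c -> e c f -> e f g -> e g a -> False.
Proof.
move=> ab bc cf fg ga; apply: (@no_short_cycle [:: a; b; c; f; g]) => //=; last first.
  by rewrite ab bc cf fg ga.
have chord x y z s t : e x y -> e y z -> e z s -> e s t -> e t x -> x != z.
  by move=> _ _ zs st tx; apply/eqP=> E; rewrite E in tx; apply: (no_triangle zs st tx).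
rewrite !inE !negb_or (chord a b c f g) // (chord b c f g a) // (chord c f g a b) //.
rewrite (eq_sym a f) (chord f g a b c) // (eq_sym b g) (chord g a b c f) //.
by rewrite (eq_sym a g) !adjneq.
Qed.

(** Only vertices two steps apart must be assumed distinct; if opposite ones coincided, they would
    close a triangle. *)
Lemma no_C6 (a b c f g h : T) :
  e a b -> e b c -> e c f -> e f g -> e g h -> e h a ->
  uniq [:: a; c; g] -> uniq [:: b; f; h] -> False.
Proof.
move=> ab bc cf fg gh ha; rewrite /= !inE !negb_or !andbT.
move=> /andP[/andP[ac ag] cg] /andP[/andP[bf bh] fh].
apply: (@no_short_cycle [:: a; b; c; f; g; h]) => //=; last first.
  by rewrite ab bc cf fg gh ha.
have opp x y z s : e x y -> e y z -> e z s -> x != s.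
  by move=> xy yz zs; apply/eqP=> E; rewrite -E in zs; apply: (no_triangle xy yz zs).
rewrite !inE !negb_or ac ag cg bf bh fh (opp a b c f) // (opp b c f g) // (opp c f g h) //.
by rewrite (eq_sym a h) !adjneq.
Qed.

(** Without [x1] every centre still has a kept leaf, as [x2] serves [g x1]. A vertex not resolved
    from a centre is adjacent to that kept leaf, so two unresolved centres span a 4-cycle; the pair
    of [x1] and a centre is left to [bad]. *)
Lemma nl_dim_forest (X : {set T}) (g : T -> T) (x1 x2 : T) :
  (forall x, x \in X -> e x (g x)) -> (forall x, x \in X -> g x \notin X) ->
  (forall v, v \notin X -> exists2 x, x \in X & g x = v) ->
  x1 \in X -> x2 \in X -> x1 != x2 -> g x1 = g x2 -> nl_dim e <= #|X|.-1.
Proof.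
move=> eg gX Xg x1X x2X x12 g12.
have -> : #|X|.-1 = #|X :\ x1| by rewrite (cardsD1 x1 X) x1X.
apply: nl_dim_le; apply: nonlocal_resolvingP.
have cov v : v \notin X -> exists2 x, x \in X :\ x1 & g x = v.
  move/Xg=> [x xX xv]; case: (eqVneq x x1) => [xx1|xx1]; last by exists x; rewrite ?inE ?xx1.
  by exists x2; rewrite ?inE 1?eq_sym ?x12 // -g12 -xx1.
have outX u v : u != v -> (forall x, x \in X :\ x1 -> d u x = d v x) -> u \notin X :\ x1.
  move=> uv uvE; apply/negP=> /uvE/eqP; rewrite distxx // eq_sym dist_eq0 //.
  by rewrite eq_sym (negPf uv).
have adjX u v x : x \in X :\ x1 -> g x = u ->
    (forall x, x \in X :\ x1 -> d u x = d v x) -> e v x.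
  move=> xX gu uvE; rewrite -(dist_eq1 eI) // -uvE // dist_eq1 // -gu eS eg //.
  by case/setD1P: xX.
(* The kept leaf [y] of [v] is adjacent to [x1], and [v] is within distance 2 of [x2] because [x1]
   is, through the common centre. The closed walk [x1], [g x1], [x2], [z], [v], [y] then yields a
   cycle of length 6, of length 5 if [z = x2], or of length 4 if [z] is [g x1] or [y]. *)
have bad u v : u = x1 -> v \notin X -> ~~ e u v ->
    (forall x, x \in X :\ x1 -> d u x = d v x) -> False.
  move=> -> vX nuv uvE; have [y yX1 gy] := cov v vX.
  have x1y : e x1 y by apply: adjX yX1 gy _ => x /uvE.
  have /setD1P[yx1 yX] := yX1.
  have yv : e y v by rewrite -gy eg.
  have vc : v != g x1 by apply: contraNneq nuv => ->; apply: eg.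
  have yx2 : y != x2 by apply: contra_neq vc; rewrite g12 -gy => ->.
  have x1c : e x1 (g x1) by apply: eg.
  have cx2 : e (g x1) x2 by rewrite eS g12 eg.
  have vy : e v y by rewrite eS.
  have yx1' : e y x1 by rewrite eS.
  have cy : g x1 != y by apply: contraTneq yX => <-; apply: gX.
  have nX x : x \in X -> x != v by apply: contraTneq => ->.
  have dv : d v x2 <= 2.
    rewrite -uvE ?inE 1?eq_sym ?x12 //; have := dist_triangle eC x1 (g x1) x2.
    by move: x1c cx2; rewrite -!(dist_eq1 eI) // => /eqP-> /eqP->.
  have [z vz dz] : exists2 z, e v z & d v x2 = (d z x2).+1.
    by apply: dist_step => //; rewrite eq_sym nX.
  have : d z x2 <= 1 by rewrite -ltnS -dz.
  rewrite leq_eqVlt ltnS leqn0 dist_eq1 // dist_eq0 // => /orP[zx2 | /eqP zx2].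
    have zc : z != g x1.
      apply/eqP=> zc; rewrite zc eS in vz.
      by apply: (no_C4 x1c vz vy yx1'); rewrite ?nX.
    have zy : z != y.
      by apply/eqP=> zy; rewrite zy eS in zx2; apply: (no_C4 x1c cx2 zx2 yx1').
    rewrite eS in vz; rewrite eS in zx2.
    apply: (no_C6 x1c cx2 zx2 vz vy yx1'); rewrite /= !inE !negb_or ?x12 ?nX //.
    by rewrite cy zy eq_sym zc.
  rewrite zx2 eS in vz.
  exact: (no_C5 x1c cx2 vz vy yx1').
move=> u v uv nuv uvE.
have uX1 := outX u v uv uvE.
have vX1 : v \notin X :\ x1 by apply: (outX v u); [rewrite eq_sym | move=> x /uvE].
have vuE x : x \in X :\ x1 -> d v x = d u x by move/uvE.
have inX w : w \notin X :\ x1 -> w = x1 \/ w \notin X.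
  by rewrite !inE negb_and negbK => /orP[/eqP|]; [left | right].
have [ux1|uX] := inX u uX1.
  have [vx1|vX] := inX v vX1; first by rewrite ux1 vx1 eqxx in uv.
  exact: (bad u v).
have [vx1|vX] := inX v vX1; first by apply: (bad v u) => //; rewrite eS.
have [x xX gx] := cov u uX; have [y yX gy] := cov v vX.
have vx := adjX u v x xX gx uvE; have uy := adjX v u y yX gy vuE.
have /setD1P[_ xX'] := xX; have /setD1P[_ yX'] := yX.
have xu : e x u by rewrite -gx eg.
have yv : e y v by rewrite -gy eg.
apply: (no_C4 xu uy yv vx) => //; by apply: contra_neq uv; rewrite -gx -gy => ->.
Qed.

(* When the forest is a perfect matching, one edge [x1 -- g x1] is dropped, and of
   every other edge the endpoint not adjacent to [x1] or [g x1] is kept. *)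
Lemma nl_dim_matching (X : {set T}) (g : T -> T) (x1 : T) :
  (forall x, x \in X -> e x (g x)) -> (forall x, x \in X -> g x \notin X) ->
  (forall v, v \notin X -> exists2 x, x \in X & g x = v) ->
  {in X &, injective g} -> x1 \in X -> nl_dim e <= #|X|.-1.
Proof.
move=> eg gX Xg gI x1X; pose c1 := g x1.
have x1c : e x1 c1 by apply: eg.
pose phi x := if e x x1 || e x c1 then g x else x.
pose Y := phi @: (X :\ x1).
have le_Y : #|Y| <= #|X|.-1.
  by apply: leq_trans (leq_imset_card _ _) _; rewrite (cardsD1 x1 X) x1X.
apply: leq_trans le_Y; apply: nl_dim_le; apply: nonlocal_resolvingP.
(* When [phi] switches to [g x], the vertex [x] already sees the dropped edge; if [g x] saw it too,
   a triangle or a 4-cycle would appear. *)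
have far x : x \in X :\ x1 -> ~~ e (phi x) x1 /\ ~~ e (phi x) c1.
  case/setD1P=> xx1 xX; have xg := eg x xX.
  have gc : g x != c1 by apply: contra_neq xx1; apply: gI.
  have xc : x != c1 by apply: contraTneq xX => ->; apply: gX.
  have gx1 : g x != x1 by apply: contraNneq (gX x xX) => ->.
  rewrite /phi; case: ifPn => [|/norP[] //].
  rewrite eS in xg; case/orP=> xe; split; apply/negP=> ge; rewrite eS in ge.
  - exact: (no_triangle ge xg xe).
  - by apply: (no_C4 ge xg xe x1c) => //; rewrite eq_sym.
  - by rewrite eS in x1c; apply: (no_C4 ge xg xe x1c) => //; rewrite eq_sym.
  - exact: (no_triangle ge xg xe).
have phiI : {in X :\ x1 &, injective phi}.
  move=> x y /setD1P[_ xX] /setD1P[_ yX]; rewrite /phi; case: ifP => _; case: ifP => _ //.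
  - exact: gI.
  - by move=> E; have := gX x xX; rewrite E yX.
  - by move=> E; have := gX y yX; rewrite -E xX.
(* Outside the dropped edge, a vertex not kept is the matching partner of a kept one. The last
   equation recovers it from [x], which ends the proof through injectivity of [phi]. *)
have cov v : v != x1 -> v != c1 -> v \notin Y ->
    exists x, [/\ x \in X :\ x1, e v (phi x) & v = if phi x == x then g x else x].
  move=> vx1 vc1 vY.
  have [x xX vx] : exists2 x, x \in X :\ x1 & v = x \/ v = g x.
    case: (boolP (v \in X)) => [vX | /Xg[x xX gx]]; first by exists v; rewrite ?inE ?vx1; auto.
    exists x; last by right.
    by rewrite !inE xX andbT; apply: contraNneq vc1 => xx1; rewrite -gx xx1.
  have pY : phi x \in Y by apply: imset_f.
  have /setD1P[_ xX'] := xX; have xg := eg x xX'.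
  exists x; move: pY vY; rewrite /phi; case: ifP vx => _ [] -> pY; rewrite ?pY //= => _.
    by rewrite (eq_sym (g x)) (negPf (adjneq xg)).
  by rewrite eqxx eS.
have dY u v : u != v -> (forall x, x \in Y -> d u x = d v x) -> u \notin Y.
  move=> uv uvE; apply/negP=> /uvE/eqP; rewrite distxx // eq_sym dist_eq0 //.
  by rewrite eq_sym (negPf uv).
(* Here [u] would be as close as [v] to the kept partner of [v], hence adjacent to it, against
   [far]. *)
have bad u v : u = x1 \/ u = c1 -> u != v -> ~~ e u v ->
    (forall x, x \in Y -> d u x = d v x) -> False.
  move=> u1 uv nuv uvE.
  have vY : v \notin Y by apply: (dY v u); [rewrite eq_sym | move=> x /uvE].
  have vx1 : v != x1.
    by case: u1 uv nuv => ->; [rewrite eq_sym | move=> _; apply: contraNneq => ->; rewrite eS].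
  have vc1 : v != c1.
    by case: u1 uv nuv => ->; [move=> _; apply: contraNneq => -> | rewrite eq_sym].
  have [x [xX vx _]] := cov v vx1 vc1 vY; have [f1 f2] := far x xX.
  have : e u (phi x) by rewrite -(dist_eq1 eI) // uvE ?imset_f // dist_eq1.
  by rewrite eS; apply/negP; case: u1 => ->.
move=> u v uv nuv uvE.
have vuE x : x \in Y -> d v x = d u x by move/uvE.
case: (eqVneq u x1) => [u1|ux1]; first by apply: (bad u v) => //; left.
case: (eqVneq u c1) => [u1|uc1]; first by apply: (bad u v) => //; right.
have vu : v != u by rewrite eq_sym.
have nvu : ~~ e v u by rewrite eS.
case: (eqVneq v x1) => [v1|vx1]; first by apply: (bad v u) => //; left.
case: (eqVneq v c1) => [v1|vc1]; first by apply: (bad v u) => //; right.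
have [x [xX ux uE]] := cov u ux1 uc1 (dY u v uv uvE).
have [y [yX vy vE]] := cov v vx1 vc1 (dY v u vu vuE).
have xv : e (phi x) v by rewrite eS -(dist_eq1 eI) // -uvE ?imset_f // dist_eq1.
have yu : e (phi y) u by rewrite eS -(dist_eq1 eI) // uvE ?imset_f // dist_eq1.
apply: (no_C4 ux xv vy yu uv); apply: contra_neq uv => /(phiI x y xX yX) xy.
by rewrite uE vE xy.
Qed.

Theorem nl_dim_le_edge_cover : 1 < #|T| -> nl_dim e <= edge_cover_number e - 1.
Proof.
move=> T2; have [X [g [leX eg gX Xg]]] := star_forest eS eI eC T2.
rewrite subn1; apply: leq_trans (_ : #|X|.-1 <= _); last by lia.
case: (boolP [exists x in X, exists y in X, (x != y) && (g x == g y)]).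
  case/exists_inP=> x xX /exists_inP[y yX /andP[xy /eqP gxy]].
  exact: nl_dim_forest xX yX xy gxy.
move=> /exists_inPn ninj.
have gI : {in X &, injective g}.
  move=> x y xX yX gxy; apply/eqP/negPn/negP=> xy.
  by have /exists_inPn/(_ y yX) := ninj x xX; rewrite xy gxy eqxx.
have /card_gt0P[v _] : 0 < #|T| by apply: ltnW.
have [x xX] : exists x, x \in X.
  by case: (boolP (v \in X)) => [|/Xg[x]]; [exists v | exists x].
exact: nl_dim_matching gI xX.
Qed.
End Girth.

(** * Distances and branches in a tree *)

Section Tree.
Variables (T : finType) (e : rel T).
Hypotheses (eS : symmetric e) (eI : irreflexive e) (eC : connectedG e).
Hypothesis (eA : acyclic e).
Local Notation d := (dist e).

Let adjneq := adj_neq eI.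

(* Otherwise shortest paths from [a] and [b] to [x] avoid [w] and close a cycle. *)
Lemma tree_closer_uniq (w a b x : T) :
  e w a -> e w b -> d a x <= d w x -> d b x <= d w x -> a = b.
Proof.
move=> wa wb da db; apply/eqP/negPn/negP=> ab.
(* Adjacency in the graph with [w] deleted. *)
pose r : rel T := fun y z => [&& e y z, y != w & z != w].
have toX n y : d y x <= n -> y != w -> d y x <= d w x -> connect r y x.
  elim: n y => [|n IHn] y dn yw dy.
    by move: dn; rewrite leqn0 dist_eq0 // => /eqP ->.
  case: (eqVneq y x) => [->|yx]; first exact: connect0.
  have [z yz dz] := dist_step eI eC yx.
  have zw : z != w by apply: contraTneq dy => <-; rewrite dz ltnn.
  have ryz : r y z by rewrite /r yz yw zw.
  apply: connect_trans (connect1 ryz) _.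
  by apply: IHn => //; lia.
have rS : connect_sym r by apply: sym_connect_sym => y z; rewrite /r eS [(y != w) && _]andbC.
have aw : a != w by rewrite eq_sym adjneq.
have bw : b != w by rewrite eq_sym adjneq.
have : connect r a b.
  by apply: connect_trans (toX _ a (leqnn _) aw da) _; rewrite rS (toX _ b (leqnn _) bw db).
case/connectP=> q /shortenP[p ap Up _] bp.
have wp : w \notin a :: p.
  rewrite inE eq_sym negb_or aw /=; elim: p (a) ap {Up bp} => //= y p IHp z.
  by case/andP=> /and3P[_ _ yw] /IHp; rewrite inE eq_sym negb_or yw.
have ep : path e a p by apply: sub_path ap => y z /and3P[].
have /negP := eA [:: w, a & p]; apply.
rewrite /is_cycle cons_uniq wp Up /= wa rcons_path ep -bp eS wb /=.
by case: (p) bp ab => //= ->; rewrite eqxx.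
Qed.

(** With equal distances, [b] and the next vertex from [a] towards [x] would both be no farther from
    [x] than [a], hence equal. *)
Lemma tree_adj_dist (a b x : T) : e a b -> d a x != d b x.
Proof.
move=> ab; apply/eqP=> dab; case: (eqVneq a x) => [ax|ax].
  move: dab; rewrite ax distxx // => /esym/eqP; rewrite dist_eq0 // => /eqP bx.
  by rewrite ax bx eI in ab.
have [z az dz] := dist_step eI eC ax.
have := @tree_closer_uniq a b z x ab az; rewrite -dab leqnn => /(_ isT).
by move=> E; have := E ltac:(lia) => bz; move: dz; rewrite -bz dab; lia.
Qed.

Lemma tree_adj_distE (a b x : T) : e a b -> d a x = (d b x).+1 \/ d b x = (d a x).+1.
Proof.
move=> ab; have := tree_adj_dist x ab; have := adj_dist_le eI eC x ab.
have := adj_dist_le eI eC x (_ : e b a); rewrite eS => /(_ ab); lia.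
Qed.

(** Induction along the path from [x] to [u]. If the step from [x] to [x'] led away from [y], then
    [x] and the next vertex after [x'] (which is [v] when [x' = u]) would both be nearer to [y] than
    [x'], contradicting [tree_closer_uniq]. *)
Lemma tree_edge_separates (x y u v : T) :
  e u v -> d x u < d x v -> d y v < d y u -> d x y = (d x u + d v y).+1.
Proof.
move=> uv + yvu; have [n] := ubnP (d x u); elim: n x => // n IHn x xn xuv.
have uvy : d u y = (d v y).+1.
  by have := tree_adj_distE y uv; rewrite !(dist_sym eS eC _ y); lia.
case: (eqVneq x u) => [->|xu]; first by rewrite distxx.
have [x' xx' dx'] := dist_step eI eC xu.
have x'uv : d x' u < d x' v by have := adj_dist_le eI eC v xx'; lia.
have dx'y : d x' y = (d x' u + d v y).+1 by apply: IHn => //; lia.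
have [|dxy] := tree_adj_distE y xx'; first by lia.
have x'x : e x' x by rewrite eS.
case: (eqVneq x' u) => [x'u|x'u].
  rewrite x'u in x'x dxy; have xv : x = v by apply: (@tree_closer_uniq u _ _ y) => //; lia.
  by move: xuv; rewrite xv distxx.
have [x'' xx'' dx''] := dist_step eI eC x'u.
have x''uv : d x'' u < d x'' v by have := adj_dist_le eI eC v xx''; lia.
have dx''y : d x'' y = (d x'' u + d v y).+1 by apply: IHn => //; lia.
have E : x = x'' by apply: (@tree_closer_uniq x' _ _ y) => //; lia.
by move: dx'; rewrite dx'' E; lia.
Qed.

(** Throughout, [d x a < d x w] encodes that [x] lies in the branch of [a] at its neighbour [w]. An
    unresolved pair is moved one step towards [x0] and stays unresolved; once both members step to
    the same vertex, the two branches there contradict the hypothesis. *)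
Lemma tree_resolving (X : {set T}) (x0 : T) : x0 \in X ->
  (forall w a b, e w a -> e w b -> a != b ->
     exists2 x, x \in X & d x a < d x w \/ d x b < d x w) ->
  nonlocal_resolvingb e X.
Proof.
move=> x0X H; apply: nonlocal_resolvingP => u v uv _.
have [n] := ubnP (d u x0); elim: n u v uv => // n IHn u v uv un uvE.
have dc := dist_sym eS eC.
have ux0 : u != x0.
  apply: contraTneq uv => ux; have := uvE x0 x0X; rewrite ux distxx // => /esym/eqP.
  by rewrite dist_eq0 // => /eqP ->; rewrite eqxx.
have vx0 : v != x0 by rewrite -(dist_eq0 eC) -uvE // dist_eq0.
have [u' uu' du'] := dist_step eI eC ux0; have [v' vv' dv'] := dist_step eI eC vx0.
case: (eqVneq u' v') => [E|u'v'].
  rewrite -E in vv'; rewrite eS in uu'; rewrite eS in vv'.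
  have [x xX] := H _ _ _ uu' vv' uv; rewrite !(dc x) uvE // => dx.
  by move/eqP: uv; apply; apply: (@tree_closer_uniq u' _ _ x) => //; rewrite ?uvE //; lia.
(* One member cannot move away from [x] while the other approaches it: the edge from [a] to [a']
   would separate [x] from [x0], and the route through [b'] would be shorter by 2 than the distance
   this forces. *)
have far x a a' b b' : x \in X -> e a a' -> e b b' -> d a x = d b x ->
  d a x0 = d b x0 -> d a x0 = (d a' x0).+1 -> d b x0 = (d b' x0).+1 ->
  d a' x = (d a x).+1 -> d b x = (d b' x).+1 -> False.
  move=> xX aa' bb' dab dab0 da0 db0 da db.
  have := @tree_edge_separates x x0 a a' aa'; rewrite !(dc _ a) (dc x a') (dc x0 a').
  have := dist_triangle eC x b' x0; rewrite (dc x b'); lia.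
apply: (IHn u' v') => //; first by lia.
move=> x xX; have := uvE x xX; have := uvE x0 x0X => d0 dx.
have := @far x u u' v v' xX uu' vv' dx d0 du' dv'.
have := @far x v v' u u' xX vv' uu' (esym dx) (esym d0) dv' du'.
have := tree_adj_distE x uu'; have := tree_adj_distE x vv'; lia.
Qed.

Definition leaf (v : T) : bool := #|[set y | e v y]| == 1.

Lemma leaf_adj_uniq (v a b : T) : leaf v -> e v a -> e v b -> a = b.
Proof.
by move=> /eqP lv va vb; apply: (card_le1_eqP (eq_leq lv)); rewrite inE.
Qed.

Lemma nonleafP (v : T) : 1 < #|T| -> ~~ leaf v -> exists a b, [/\ e v a, e v b & a != b].
Proof.
move=> T2 nl; have [y vy] := ex_adj eI eC v T2.
have : 1 < #|[set y | e v y]|.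
  rewrite ltn_neqAle eq_sym nl; apply/card_gt0P; exists y; rewrite inE //.
by case/card_gt1P=> a [b []]; rewrite !inE => va vb ab; exists a, b.
Qed.

Lemma adj2_nonleaf (v a b : T) : e v a -> e v b -> a != b -> ~~ leaf v.
Proof. by move=> va vb; apply: contra_neqN => lv; apply: (leaf_adj_uniq lv). Qed.

(** Take a vertex of the branch farthest from [w]. All its neighbours are nearer to [w], and in a
    tree only one can be. *)
Lemma branch_leaf (w a : T) : 1 < #|T| -> e w a -> exists2 l, leaf l & d l a < d l w.
Proof.
move=> T2 wa; have aw : d a a < d a w.
  by rewrite distxx // lt0n dist_eq0 // eq_sym adjneq.
case: (@arg_maxnP _ a (fun y => d y a < d y w) (fun y => d y w) aw) => y yaw ymax.
exists y => //; apply/negPn/negP=> /(nonleafP T2)[z1 [z2 [yz1 yz2 z12]]].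
have no z : e y z -> d z w < d y w.
  move=> yz; have [->//|E] := tree_adj_distE w yz.
  have zy : e z y by rewrite eS.
  by have := adj_dist_le eI eC a zy; have := ymax z; lia.
by move/eqP: z12; apply; apply: (@tree_closer_uniq y _ _ w); rewrite // ltnW ?no.
Qed.

Lemma parent_nonleaf (s t c : T) : e s t -> d s c = (d t c).+1 -> t != c ->
  exists p, [/\ e t p, d t c = (d p c).+1, p != s & ~~ leaf t].
Proof.
move=> st ds tc; have [p tp dp] := dist_step eI eC tc.
have ps : p != s.
  by apply/eqP=> E; have := leqnn (d s c); rewrite {1}ds dp E ltnNge leqnSn.
by exists p; split=> //; apply: adj2_nonleaf tp _ ps; rewrite eS.
Qed.
End Tree.

(** * Leaves of a tree with at least three vertices *)

Section TreeLeaves.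
Variables (T : finType) (e : rel T).
Hypotheses (eS : symmetric e) (eI : irreflexive e) (eC : connectedG e).
Hypothesis (eA : acyclic e) (T3 : 2 < #|T|).
Local Notation d := (dist e).
Local Notation lf := (leaf e).
Let L := [set v | lf v].

Let adjneq := adj_neq eI.
Let T2 : 1 < #|T| := ltnW T3.
Let closer_uniq := tree_closer_uniq eS eI eC eA.
Let adjE := tree_adj_distE eS eI eC eA.
Let dc := dist_sym eS eC.

Lemma leaf_dist (l c y : T) : lf l -> e l c -> l != y -> d l y = (d c y).+1.
Proof.
by move=> ll lc ly; have [z lz ->] := dist_step eI eC ly; rewrite (leaf_adj_uniq ll lc lz).
Qed.

(** Two adjacent leaves would leave no room for a third vertex: each would be farther from it than
    the other. *)
Lemma adj_leaf_nonleaf (l c : T) : lf l -> e l c -> ~~ lf c.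
Proof.
move=> ll lc; apply/negP=> cl; move: T3; rewrite ltnNge => /negP; apply.
apply: leq_trans (_ : #|[set l; c]| <= 2); last by rewrite cards2; case: (_ != _).
apply/subset_leq_card/subsetP=> y _; apply/set2P.
case: (eqVneq l y) => [->|ly]; first by left.
case: (eqVneq c y) => [->|cy]; first by right.
have cl' : e c l by rewrite eS.
by have := leaf_dist ll lc ly; have := leaf_dist cl cl' cy; lia.
Qed.

Lemma ex_nonleaf : exists c, ~~ lf c.
Proof.
have /card_gt0P[x _] : 0 < #|T| by apply: ltnW.
have [y xy] := ex_adj eI eC x T2.
case: (boolP (lf x)) => lx; last by exists x.
by exists y; apply: adj_leaf_nonleaf xy.
Qed.

(** Every cover contains all pendant edges, and these are distinct since leaves are pairwise
    non-adjacent. In case of equality a minimum cover consists of pendant edges only, so they reach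
    every inner vertex. *)
Lemma pendant_edges :
  #|L| <= edge_cover_number e /\
  (#|L| = edge_cover_number e -> forall v, ~~ lf v -> exists2 l, lf l & e v l).
Proof.
have /fin_all_exists[s es] := fun x : T => ex_adj eI eC x T2.
have [F /andP[/subsetP FE /forallP cF] <-] := edge_cover_min eI eC T2.
pose P := [set [set l; s l] | l in L].
have PF : P \subset F.
  apply/subsetP=> _ /imsetP[l + ->]; rewrite inE => ll.
  have /exists_inP[A AF lA] := cF l; have /imsetP[[a b]] := FE A AF.
  rewrite inE /= => ab AE; move: lA; rewrite AE => /set2P[] lE; rewrite -lE in ab AE.
    by rewrite (leaf_adj_uniq ll (es l) ab) -AE.
  by rewrite eS in ab; rewrite (leaf_adj_uniq ll (es l) ab) setUC -AE.
have cardP : #|P| = #|L|.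
  apply: card_in_imset => l l'; rewrite !inE => ll ll' E.
  have : l \in [set l'; s l'] by rewrite -E set21.
  case/set2P=> // lE; have := adj_leaf_nonleaf ll' (es l').
  by rewrite -lE ll.
split=> [|E v nv]; first by rewrite -cardP subset_leq_card.
have EP : P = F by apply/eqP; rewrite eqEcard PF cardP E /=.
have /exists_inP[A + vA] := cF v; rewrite -EP => /imsetP[l].
rewrite inE => ll AE; move: vA; rewrite AE => /set2P[vE|->].
  by rewrite vE ll in nv.
by exists l; rewrite // eS.
Qed.

Lemma branch_leaves (w a b : T) : e w a -> e w b -> a != b ->
  exists la lb, [/\ lf la, lf lb, d la a < d la w, d lb b < d lb w & la != lb].
Proof.
move=> wa wb ab; have [la lla da] := branch_leaf eS eI eC eA T2 wa.
have [lb llb db] := branch_leaf eS eI eC eA T2 wb.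
exists la, lb; split=> //; apply: contra_neq ab => E; rewrite -E in db.
by apply: (@closer_uniq w _ _ la) => //; rewrite dc (dc w) ltnW.
Qed.

Lemma leaves_gt1 : 1 < #|L|.
Proof.
have [c /(nonleafP eI eC T2)[a [b [ca cb ab]]]] := ex_nonleaf.
have [la [lb [lla llb _ _ lab]]] := branch_leaves ca cb ab.
by apply/card_gt1P; exists la, lb; rewrite !inE.
Qed.

(** Two branches at a vertex contain distinct leaves, so dropping one leaf leaves at least one of
    them met. *)
Lemma nl_dim_leaves : nl_dim e <= #|L|.-1.
Proof.
have /card_gt1P[l [l' [lL l'L ll']]] := leaves_gt1.
have -> : #|L|.-1 = #|L :\ l| by rewrite (cardsD1 l L) lL.
apply: nl_dim_le; apply: (@tree_resolving _ _ eS eI eC eA _ l').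
  by rewrite in_setD1 eq_sym ll'.
move=> w a b wa wb ab; have [la [lb [lla llb da db lab]]] := branch_leaves wa wb ab.
case: (eqVneq la l) => [E|E]; last by exists la; [rewrite !inE E | left].
by exists lb; [rewrite !inE -E eq_sym lab | right].
Qed.

(** A branch with a single leaf [l] is a path: each neighbour of [c] farther from [w] leads to a
    leaf of the branch, which must be [l], so it is nearer to [l] than [c]; only one neighbour can
    be. *)
Lemma single_leaf_branch (w a c l z z' : T) :
  (forall q, lf q -> d q a < d q w -> q = l) -> d c a < d c w ->
  e c z -> e c z' -> d c w < d z w -> d c w < d z' w -> z = z'.
Proof.
move=> ql ca cz cz' dz dz'.
have child y : e c y -> d c w < d y w -> d y l < d c l.
  move=> cy dy; have [q lq dq] := branch_leaf eS eI eC eA T2 cy.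
  have yc : e y c by rewrite eS.
  have qw : d q w = (d q y + d c w).+1.
    by apply: (tree_edge_separates eS eI eC eA yc); rewrite // !(dc w).
  have := dist_triangle eC q c a; have := adj_dist_le eI eC q cy => qc qa.
  rewrite (dc q c) in qa; rewrite (dc q y) in qw.
  by rewrite -(ql q lq); [rewrite dc (dc c) | lia].
by apply: (@closer_uniq c _ _ l) => //; rewrite ltnW ?child.
Qed.

Lemma leaf_adj_branch (w a l c : T) :
  lf l -> e l c -> d l a < d l w -> c != w -> e w a -> ~~ lf w -> d c a < d c w.
Proof.
move=> ll lc law cw wa nw.
have lw : l != w by apply: contraNneq nw => <-.
have la : l != a.
  by apply: contraNneq cw => E; rewrite (leaf_adj_uniq ll lc (_ : e l w)) // E eS.
by move: law; rewrite !(leaf_dist ll lc).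
Qed.

(** * The equality case: locating the centre *)

Hypothesis support : forall v, ~~ lf v -> exists2 l, lf l & e v l.
Hypothesis tight : #|L|.-2 < nl_dim e.

(** The branches of [a] and [b] at [w] are paths ending in [l] and [l']. Having three neighbours,
    [c] fits in no such path, so [c = w]; then [s] lies on the path towards [l']. *)
Lemma single_leaf_branches (c s l l' w a b z1 z2 z3 : T) :
  ~~ lf c -> ~~ lf s -> s != c -> lf l -> e c l -> lf l' -> e s l' ->
  e c z1 -> e c z2 -> e c z3 -> [/\ z1 != z2, z2 != z3 & z3 != z1] ->
  e w a -> e w b -> a != b ->
  (forall q, lf q -> d q a < d q w -> q = l) ->
  (forall q, lf q -> d q b < d q w -> q = l') ->
  e c s /\ (forall y z, e s y -> e s z -> y != c -> z != c -> y = z).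
Proof.
move=> nc ns sc ll cl ll' sl' cz1 cz2 cz3 [z12 z23 z31] wa wb ab qa qb.
have nw : ~~ lf w by apply: adj2_nonleaf wa wb ab.
have [la law lad] := branch_leaf eS eI eC eA T2 wa.
have [lb lbw lbd] := branch_leaf eS eI eC eA T2 wb.
have {law}laE := qa la law lad; have {lbw}lbE := qb lb lbw lbd.
rewrite laE in lad; rewrite lbE in lbd.
have lc : e l c by rewrite eS.
have l's : e l' s by rewrite eS.
(* Otherwise [c] has at most one neighbour farther from [w] and at most one nearer, and three
   neighbours are too many. *)
have E : c = w.
  apply/eqP/negPn/negP=> cw; have cin := leaf_adj_branch ll lc lad cw wa nw.
  have up y z : e c y -> e c z -> y != z -> ~ (d c w < d y w /\ d c w < d z w).
    by move=> cy cz yz [dy dz]; move/eqP: yz; apply; apply: (single_leaf_branch qa cin).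
  have down y z : e c y -> e c z -> y != z -> ~ (d y w < d c w /\ d z w < d c w).
    by move=> cy cz yz [dy dz]; move/eqP: yz; apply; apply: (@closer_uniq c _ _ w); rewrite // ltnW.
  have [[h1|h1] [h2|h2] [h3|h3]] := And3 (adjE w cz1) (adjE w cz2) (adjE w cz3);
    solve [ by apply: (up _ _ cz1 cz2 z12); split; [rewrite h1 | rewrite h2]
          | by apply: (up _ _ cz2 cz3 z23); split; [rewrite h2 | rewrite h3]
          | by apply: (up _ _ cz3 cz1 z31); split; [rewrite h3 | rewrite h1]
          | by apply: (down _ _ cz1 cz2 z12); split; [rewrite h1 | rewrite h2]
          | by apply: (down _ _ cz2 cz3 z23); split; [rewrite h2 | rewrite h3]
          | by apply: (down _ _ cz3 cz1 z31); split; [rewrite h3 | rewrite h1]].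
rewrite -{w}E in wa wb qa qb nw lad lbd *.
have sin : d s b < d s c := leaf_adj_branch ll' l's lbd sc wb nc.
(* If the next vertex [t] from [s] towards [c] were not [c], it would have its own leaf [l2]
   pointing away from [c], as [s] does; the path property gives [s = l2], but [s] is inner. *)
have cs : e c s.
  have [t st dt] := dist_step eI eC sc.
  case: (eqVneq t c) => [<-|tc]; first by rewrite eS.
  have tin : d t b < d t c.
    have cb := wb; have := tree_adj_dist eS eI eC eA t cb.
    rewrite !(dc _ t) neq_ltn => /orP[tcb|//].
    have := tree_edge_separates eS eI eC eA cb tcb sin.
    move: st; rewrite eS -(dist_eq1 eI) // => /eqP ->; move: tc; rewrite -(dist_eq0 eC).
    by case: (d t c).
  have [p [tp dp ps nt]] := parent_nonleaf eS eI eC st dt tc.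
  have [l2 ll2 tl2] := support nt.
  have l2t : e l2 t by rewrite eS.
  have l2c : l2 != c by apply: contraNneq nc => <-.
  have : s = l2.
    apply: (single_leaf_branch qb tin) => //; first by rewrite eS.
      by rewrite dt.
    by rewrite (leaf_dist ll2 l2t l2c).
  by move=> E; rewrite E ll2 in ns.
split=> // y z sy sz yc zc; apply: (single_leaf_branch qb sin) => //.
- by have := adjE c sy; move: yc cs; rewrite eS -(dist_eq0 eC) -(dist_eq1 eI) // => + /eqP->;
    case: (d y c) => // k _ [|->].
- by have := adjE c sz; move: zc cs; rewrite eS -(dist_eq0 eC) -(dist_eq1 eI) // => + /eqP->;
    case: (d z c) => // k _ [|->].
Qed.

(** Dropping a leaf at [c] and one at [s] leaves too few vertices to resolve, so the criterion of
    [tree_resolving] fails: at some [w] two branches contain only dropped leaves, one each, and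
    [single_leaf_branches] applies. *)
Lemma branching_center (c s z1 z2 z3 : T) :
  e c z1 -> e c z2 -> e c z3 -> [/\ z1 != z2, z2 != z3 & z3 != z1] ->
  ~~ lf s -> s != c ->
  e c s /\ (forall y z, e s y -> e s z -> y != c -> z != c -> y = z).
Proof.
move=> cz1 cz2 cz3 z123 ns sc; have [z12 z23 z31] := z123.
have nc : ~~ lf c := adj2_nonleaf cz1 cz2 z12.
have [l ll cl] := support nc; have [l' ll' sl'] := support ns.
have l'l : l' != l.
  apply: contra_neq sc => E; rewrite eS E in sl'; rewrite eS in cl.
  exact: (leaf_adj_uniq ll).
pose X := L :\ l :\ l'.
have cardX : #|X| = #|L|.-2.
  by rewrite (cardsD1 l L) (cardsD1 l' (L :\ l)) !inE l'l ll ll'.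
(* Three branches at [c] supply three distinct leaves, of which only two are dropped. *)
have [x0 x0X] : exists x, x \in X.
  have [q1 lq1 dq1] := branch_leaf eS eI eC eA T2 cz1.
  have [q2 lq2 dq2] := branch_leaf eS eI eC eA T2 cz2.
  have [q3 lq3 dq3] := branch_leaf eS eI eC eA T2 cz3.
  have neq y z q r : e c y -> e c z -> y != z -> d q y < d q c -> d r z < d r c -> q != r.
    move=> cy cz yz qy rz; apply: contra_neq yz => E; rewrite -E in rz.
    by apply: (@closer_uniq c _ _ q) => //; rewrite dc (dc c) ltnW.
  have n12 := neq _ _ _ _ cz1 cz2 z12 dq1 dq2; have n23 := neq _ _ _ _ cz2 cz3 z23 dq2 dq3.
  have n31 := neq _ _ _ _ cz3 cz1 z31 dq3 dq1.
  case: (boolP (q1 \in X)) => [|x1]; first by exists q1.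
  case: (boolP (q2 \in X)) => [|x2]; first by exists q2.
  exists q3; move: x1 x2; rewrite !inE lq1 lq2 lq3 !andbT !negb_and !negbK.
  move=> /orP[] /eqP E1 /orP[] /eqP E2; move: n12 n23 n31; rewrite E1 E2 ?eqxx //.
    by rewrite (eq_sym l) => _ -> ->.
  by rewrite (eq_sym l') => _ -> ->.
pose bad w a b := [&& e w a, e w b, a != b &
  [forall x in X, ~~ (d x a < d x w) && ~~ (d x b < d x w)]].
have [/existsP[w /existsP[a /existsP[b]]] | nobad] :=
    boolP [exists w, exists a, exists b, bad w a b]; last first.
  suff : nonlocal_resolvingb e X by move/nl_dim_le; rewrite cardX leqNgt tight.
  apply: (tree_resolving eS eI eC eA x0X) => w a b wa wb ab.
  move: nobad => /existsPn/(_ w)/existsPn/(_ a)/existsPn/(_ b).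
  rewrite /bad wa wb ab /= => /forall_inPn[x xX]; rewrite negb_and !negbK => /orP.
  by exists x.
case/and4P=> wa wb ab /forall_inP nX.
have inX q : lf q -> (d q a < d q w) || (d q b < d q w) -> q = l \/ q = l'.
  move=> lq qab; case: (eqVneq q l) => [->|ql]; first by left.
  case: (eqVneq q l') => [->|ql']; first by right.
  have /nX : q \in X by rewrite !inE ql ql' lq.
  by rewrite -negb_or qab.
have [la [lb [lla llb da db lab]]] := branch_leaves wa wb ab.
have disj q : d q a < d q w -> d q b < d q w -> False.
  by move=> qa qb; move/eqP: ab; apply; apply: (@closer_uniq w _ _ q) => //; rewrite dc (dc w) ltnW.
have [laE|laE] := inX la lla ltac:(by rewrite da);
  have [lbE|lbE] := inX lb llb ltac:(by rewrite db orbT).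
- by rewrite laE lbE eqxx in lab.
- rewrite laE in da; rewrite lbE in db.
  apply: (single_leaf_branches nc ns sc ll cl ll' sl' cz1 cz2 cz3 z123 wa wb ab) => q lq dq.
    by have [//|E] := inX q lq ltac:(by rewrite dq); case: (@disj l'); rewrite // -E.
  by have [E|//] := inX q lq ltac:(by rewrite dq orbT); case: (@disj l); rewrite // -E.
- rewrite laE in da; rewrite lbE in db; rewrite eq_sym in ab.
  apply: (single_leaf_branches nc ns sc ll cl ll' sl' cz1 cz2 cz3 z123 wb wa ab) => q lq dq.
    by have [//|E] := inX q lq ltac:(by rewrite dq orbT); case: (@disj l'); rewrite // -E.
  by have [E|//] := inX q lq ltac:(by rewrite dq); case: (@disj l); rewrite // -E.
- by rewrite laE lbE eqxx in lab.
Qed.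

(** A vertex of degree at least 3 serves as centre. If there is none, any inner vertex does: an
    inner vertex strictly between two inner ones would get degree 3 from its own leaf. *)
Lemma tree_center : exists2 c, ~~ lf c & forall s, ~~ lf s -> s != c ->
  e c s /\ (forall y z, e s y -> e s z -> y != c -> z != c -> y = z).
Proof.
have [/existsP[c] | /existsPn small] := boolP [exists c, 2 < #|[set y | e c y]|].
  case/card_gt2P=> z1 [z2 [z3 [[]]]]; rewrite !inE => cz1 cz2 cz3 z123.
  exists c; first by case: z123 => z12 _ _; apply: adj2_nonleaf cz1 cz2 z12.
  by move=> s ns sc; apply: branching_center cz1 cz2 cz3 z123 ns sc.
have deg2 v x y z : e v x -> e v y -> e v z -> x != y -> y != z -> z != x -> False.
  move=> vx vy vz xy yz zx; move/negP: (small v); apply; apply/card_gt2P.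
  by exists x, y, z; rewrite !inE.
have [c nc] := ex_nonleaf; exists c => // s ns sc.
have cs : e c s.
  have [t st dt] := dist_step eI eC sc.
  case: (eqVneq t c) => [<-|tc]; first by rewrite eS.
  have [p [tp dp ps nt]] := parent_nonleaf eS eI eC st dt tc.
  have np : ~~ lf p.
    case: (eqVneq p c) => [->//|pc].
    by have [? [_ _ _]] := parent_nonleaf eS eI eC tp dp pc.
  have [l2 ll2 tl2] := support nt.
  have ts : e t s by rewrite eS.
  have sp : s != p by rewrite eq_sym.
  have pl2 : p != l2 by apply: contraNneq np => ->.
  have l2s : l2 != s by apply: contraNneq ns => <-.
  by case: (deg2 t s p l2 ts tp tl2 sp pl2 l2s).
split=> // y z sy sz yc zc; apply/eqP/negPn/negP=> yz.
by apply: (@deg2 s y z c); rewrite // 1?eS // eq_sym.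
Qed.
End TreeLeaves.

(** * Subdivided stars: recognition and the lower bound *)

Section SpiderIso.
Variables (T : finType) (e : rel T).
Hypotheses (eS : symmetric e) (eI : irreflexive e) (eG : girth_ge e 7).

Lemma star_subdivision_center (c l0 : T) :
  e c l0 -> (forall y, e l0 y -> y = c) ->
  (forall s y z, e c s -> e s y -> e s z -> y != c -> z != c -> y = z) ->
  (forall y, y != c -> ~~ e c y -> exists2 s, e c s & e s y) ->
  star_subdivision e.
Proof.
move=> cl0 l0c leg2 dist2.
(* The leaf [l0] is listed first, so that leg [ord0] carries the edge kept unchanged. *)
pose ns' := [seq y <- enum T | e c y && (y != l0)]; pose m := size ns'.
pose ns := l0 :: ns'; pose n (i : 'I_m.+1) := nth c ns i.
have Uns : uniq ns by rewrite /= filter_uniq ?enum_uniq // mem_filter eqxx andbF.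
have mem_ns y : (y \in ns) = e c y.
  by rewrite inE mem_filter mem_enum andbT; case: eqVneq => [->|]; rewrite ?andbT // cl0.
have nE i : e c (n i) by rewrite -mem_ns mem_nth.
have nI : injective n.
  by move=> i j /eqP; rewrite nth_uniq // => /eqP; apply: val_inj.
have nsurj y : e c y -> exists i, n i = y.
  rewrite -mem_ns => yns; have lt_y : index y ns < m.+1 by rewrite index_mem.
  by exists (Ordinal lt_y); rewrite /n nth_index.
have nc i : n i != c by rewrite eq_sym (adj_neq eI).
pose S := [set i | [exists y, e (n i) y && (y != c)]].
pose h s := odflt c [pick y | e s y && (y != c)].
have hP i : i \in S -> e (n i) (h (n i)) /\ h (n i) != c.
  rewrite inE => /existsP[y ny]; rewrite /h; case: pickP => [z /andP[]//|/(_ y)].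
  by rewrite ny.
have nS i y : e (n i) y -> y != c -> i \in S /\ h (n i) = y.
  move=> ny yc; have iS : i \in S by rewrite inE; apply/existsP; exists y; rewrite ny.
  have [nh hc] := hP i iS; split=> //; exact: (leg2 (n i)).
pose g (v : spider_vertex S) := match val v with
  | None => c | Some (i, false) => n i | Some (i, true) => h (n i) end.
(* Unwanted adjacencies are excluded by the girth: they would close a triangle, a 4-cycle or a
   5-cycle through [c]. *)
have ch i : i \in S -> e c (h (n i)) -> False.
  by move=> /hP[nh hc]; rewrite eS; apply: (no_triangle eI eG (nE i) nh).
have nn i j : e (n i) (n j) -> False.
  by move=> nij; have := nE j; rewrite eS; apply: (no_triangle eI eG (nE i) nij).
have nh i j : j \in S -> e (n i) (h (n j)) = (i == j).
  move=> jS; have [njh hc] := hP j jS; apply/idP/eqP => [nih|-> //].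
  apply/nI/eqP/negPn/negP=> nij; have cj := nE j; rewrite eS in cj.
  by rewrite eS in njh; apply: (no_C4 eI eG (nE i) nih njh cj _ nij); rewrite eq_sym.
have hh i j : i \in S -> j \in S -> e (h (n i)) (h (n j)) -> False.
  move=> /hP[nih _] /hP[njh _] hij; have cj := nE j; rewrite eS in cj; rewrite eS in njh.
  exact: (no_C5 eI eG (nE i) nih hij njh cj).
have gadj x y : e (g x) (g y) = spider_adj x y.
  rewrite /g /spider_adj.
  case: x => [[[i []]|] /= vx]; case: y => [[[j []]|] /= vy]; rewrite ?nE ?eI ?nh //.
  - by apply/negP => /hh; apply.
  - by rewrite eS nh // eq_sym.
  - by apply/negP; rewrite eS; apply: ch.
  - by apply/negP; apply: nn.
  - by rewrite eS nE.
  - by apply/negP; apply: ch.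
have gI : injective g.
  move=> [[[i []]|] vx] [[[j []]|] vy]; rewrite /g /= => E; apply: val_inj => /=; move: E.
  - by move=> E; congr (Some (_, _)); apply/eqP; rewrite -(nh i j) // -E nh.
  - by move=> E; case: (ch i vx); rewrite E.
  - by move=> E; have [_] := hP i vx; rewrite E eqxx.
  - by move=> E; case: (ch j vy); rewrite -E.
  - by move/nI->.
  - by move=> E; have := nc i; rewrite E eqxx.
  - by move=> E; have [_] := hP j vy; rewrite E eqxx.
  - by move=> E; have := nc j; rewrite E eqxx.
  - by [].
have gsurj y : exists x, g x = y.
  case: (eqVneq y c) => [->|yc]; first by exists (exist _ None isT).
  case: (boolP (e c y)) => [/nsurj[i <-]|ncy]; first by exists (exist _ (Some (i, false)) isT).
  have [s cs sy] := dist2 y yc ncy; have [i ni] := nsurj s cs; rewrite -ni in sy.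
  have [iS hE] := nS i y sy yc.
  by exists (exist _ (Some (i, true)) iS).
exists m, S; split.
  by rewrite inE; apply/existsPn=> y; apply/negP=> /andP[/l0c ->]; rewrite eqxx.
have /fin_all_exists[f fP] := gsurj.
exists f; split; first by exists g => // x; apply: gI.
by move=> x y; rewrite -gadj !fP.
Qed.

(** One edge per leg covers everything, so the cover number is at most [m.+1]; a resolving set
    misses at most one leg, so it has at least [m] vertices. *)
Lemma star_subdivision_tight : connectedG e -> star_subdivision e ->
  edge_cover_number e - 1 <= nl_dim e.
Proof.
move=> eC [m [S [S0 [f [[g fK gK] fadj]]]]].
have adjE x y : e (g x) (g y) = spider_adj x y by rewrite fadj !gK.
pose c := g (exist _ None isT).
pose a i := g (exist (spider_valid S) (Some (i, false)) isT).
have ca i : e c (a i) by rewrite adjE.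
have le_cover : edge_cover_number e <= m.+1.
  (* The outer vertex of leg [i] if the leg is subdivided, the centre otherwise. Leg [ord0] is never
     subdivided, so its edge covers the centre. *)
  pose other i := if insub (Some (i, true)) is Some v then g (v : spider_vertex S) else c.
  have ao i : e (a i) (other i).
    rewrite /other; case: insubP => [v _ vE|_]; last by rewrite eS.
    by rewrite adjE /spider_adj vE /=.
  pose F := [set [set a i; other i] | i : 'I_m.+1].
  have inF i : [set a i; other i] \in F by apply: imset_f.
  have /edge_cover_le leF : edge_coverb e F.
    apply/andP; split; first by apply/subsetP=> _ /imsetP[i _ ->]; apply: mem_edge_set.
    apply/forallP=> v; rewrite -(fK v); apply/exists_inP.
    case: (f v) => [[[i []]|] vP]; [exists [set a i; other i] | exists [set a i; other i] |
      exists [set a ord0; other ord0]]; rewrite ?inF //.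
    - rewrite /other; case: insubP => [w _ wE|]; last by rewrite vP.
      by apply/set2P; right; congr g; apply: val_inj; rewrite wE.
    - by apply/set2P; left; congr g; apply: val_inj.
    - rewrite /other insubN //; apply/set2P; right; congr g; exact: val_inj.
  by apply: leq_trans leF _; rewrite -[leqRHS]card_ord leq_imset_card.
(* The default value in [nl_dim] must also be at least [m]. *)
have leT : m <= #|T|.
  apply: leq_trans (leqnSn m) _; rewrite -[leqLHS]card_ord.
  by apply: (@leq_card _ _ a) => i j /(can_inj gK)/(congr1 val) [].
suff le_dim X : nonlocal_resolvingb e X -> m <= #|X|.
  apply: leq_trans (_ : m <= _); first by lia.
  exact: bigminn_ge.
move=> /forallP resX.
pose leg x := if val (f x) is Some (i, _) then i else ord0.
pose inleg i x := if val (f x) is Some (j, _) then i == j else false.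
(* A shortest path leaving leg [i] from [a i] starts through the centre: entering the outer vertex
   would force a return to [a i]. *)
have outleg i x : ~~ inleg i x -> dist e (a i) x = (dist e c x).+1.
  move=> nix.
  have ax : a i != x by apply: contraNneq nix => <-; rewrite /inleg gK /= eqxx.
  have [z az dz] := dist_step eI eC ax; move: az dz; rewrite -(fK z) adjE /spider_adj /=.
  case: (f z) => [[[j []]|] vj] //=; last by move=> _ ->; congr (dist e (g _) x).+1; apply: val_inj.
  move/eqP=> ij; rewrite -{j}ij in vj *; set b := g _ => dab.
  have bx : b != x by apply: contraNneq nix => <-; rewrite /inleg gK /= eqxx.
  have [y byy dby] := dist_step eI eC bx; move: byy dby; rewrite -(fK y) adjE /spider_adj /=.
  case: (f y) => [[[k []]|] vk] //= /eqP ik; rewrite -{k}ik in vk *.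
  rewrite (_ : g _ = a i); last by congr g; apply: val_inj.
  by rewrite dab => /eqP; rewrite eqn_leq !ltnNge leqnSn andbF.
have hit i j : i != j -> exists2 x, x \in X & inleg i x || inleg j x.
  move=> ij; have /forallP/(_ (a j))/implyP := resX (a i).
  have aij : (a i != a j) && ~~ e (a i) (a j).
    rewrite adjE andbT; apply: contra_neq ij => /(can_inj gK)/(congr1 val) [] //.
  move=> /(_ aij)/exists_inP[x xX dx]; exists x => //.
  apply: contraNT dx; rewrite negb_or => /andP[ix jx].
  by rewrite !outleg.
pose M := [set i | [forall x in X, ~~ inleg i x]].
have leM : #|M| <= 1.
  apply/card_le1_eqP => i j; rewrite !inE => /forall_inP iM /forall_inP jM.
  apply/eqP/negPn/negP => /hit[x xX]; rewrite (negPf (iM x xX)) (negPf (jM x xX)) //.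
have leMC : #|~: M| <= #|X|.
  apply: leq_trans (leq_imset_card leg X); apply/subset_leq_card/subsetP => i.
  rewrite !inE => /forall_inPn[x xX]; rewrite negbK => ix; apply/imsetP; exists x => //.
  by move: ix; rewrite /inleg /leg; case: (val (f x)) => [[j b]|] // /eqP.
by have := cardsC M; rewrite card_ord; lia.
Qed.
End SpiderIso.

(** * Trees attaining the bound are subdivided stars *)

Section TightTree.
Variables (T : finType) (e : rel T).
Hypotheses (eS : symmetric e) (eI : irreflexive e) (eC : connectedG e).
Hypotheses (eA : acyclic e) (eG : girth_ge e 7).

Lemma tight_tree_star_subdivision : 1 < #|T| ->
  nl_dim e = edge_cover_number e - 1 -> star_subdivision e.
Proof.
rewrite leq_eqVlt => /orP[/eqP T2 _|T3 dimE].
  (* On two vertices both ends are leaves and the leaf argument fails; the graph is a single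
     edge. *)
  have /cards2P[c [l [cl TE]]] : #|[set: T]| == 2 by rewrite cardsT -T2.
  have inT y : y = c \/ y = l by apply/set2P; rewrite -TE inE.
  have ecl : e c l.
    have [z cz _] := dist_step eI eC cl; case: (inT z) cz => -> //.
    by rewrite eI.
  apply: (star_subdivision_center eS eI eG ecl).
  - by move=> y; case: (inT y) => -> //; rewrite eI.
  - by move=> s y z _ _ _; case: (inT y) => ->; case: (inT z) => ->; rewrite ?eqxx.
  - by move=> y; case: (inT y) => ->; rewrite ?eqxx // ecl.
have T2 := ltnW T3.
have [leL support] := pendant_edges eS eI eC T3.
have leaves2 := leaves_gt1 eS eI eC eA T3.
have dimL := nl_dim_leaves eS eI eC eA T3.
(* Equality forces both links of the chain: [nl_dim e] is at most the number of leaves minus 1,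
   which is at most [edge_cover_number e - 1]. *)
have LE : #|[set v | leaf e v]| = edge_cover_number e by lia.
have tight : #|[set v | leaf e v]|.-2 < nl_dim e by lia.
have [c nc cP] := tree_center eS eI eC eA T3 (support LE) tight.
have [l0 ll0 cl0] := support LE c nc.
apply: (star_subdivision_center eS eI eG cl0).
- by move=> y l0y; apply: (leaf_adj_uniq ll0); rewrite // eS.
- move=> s y z cs sy sz yc zc; have sc : e s c by rewrite eS.
  case: (boolP (leaf e s)) => ls; first exact: (leaf_adj_uniq ls).
  by have [|_] := cP s ls; [rewrite eq_sym (adj_neq eI) | apply].
- move=> y yc ncy; have [s ys ds] := dist_step eI eC yc.
  have sc : s != c by apply: contraNneq ncy => <-; rewrite eS.
  have [p [_ _ _ ns]] := parent_nonleaf eS eI eC ys ds sc.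
  by exists s; [case: (cP s ns sc) | rewrite eS].
Qed.
End TightTree.

Theorem theorem5p3 (T : finType) (e : rel T) :
  symmetric e -> irreflexive e -> connectedG e -> 2 <= #|T| ->
  girth_ge e 7 ->
  nl_dim e <= edge_cover_number e - 1 /\
  (is_tree e -> (nl_dim e = edge_cover_number e - 1 <-> star_subdivision e)).
Proof.
move=> eS eI eC T2 eG; have le_dim := nl_dim_le_edge_cover eS eI eC eG T2.
split=> // -[_ eA]; split=> [|spider]; first exact: tight_tree_star_subdivision.
by apply/eqP; rewrite eqn_leq le_dim star_subdivision_tight.
Qed.
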